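(* There exists an absolute constant $C$ such that for all integers $t,n$ with $1 \le t < n/(100\log_2 n)$, $$\log_2 \alpha([t]^n) \le \left(1 + C\left(\frac{t \log_2^3 n}{n}\right)^{1/2}\right) N(t,n).$$
   Context: For integers $t \ge 1$ and $n \ge 1$, $[t]^n$ denotes the poset on $\{0,1,\dots,t-1\}^n$ ordered coordinatewise: $x \preceq y$ iff $x_i \le y_i$ for all $1 \le i \le n$. Its levels are the sets of elements with a fixed coordinate sum. An antichain is a set of pairwise incomparable elements; $\alpha(P)$ denotes the number of antichains of the poset $P$, including the empty antichain. $N(t,n)$ denotes the size of a largest level of $[t]^n$. *)

(* Defs.v *)
From HB Require Import structures.
From mathcomp Require Import all_boot all_order all_algebra.
From mathcomp Require Import reals exp.

Set Implicit Arguments.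
Unset Strict Implicit.
Unset Printing Implicit Defensive.

Import Order.TTheory GRing.Theory Num.Theory.

Definition antichain (d : Order.disp_t) (P : finPOrderType d) (A : {set P}) :
    bool :=
  [forall x in A, forall y in A, (x >=< y)%O ==> (x == y)].

Definition num_antichains (d : Order.disp_t) (P : finPOrderType d) : nat :=
  #|[set A : {set P} | antichain A]|.

(* The order on n.-tupleprod is coordinatewise, see [grid_leE]. *)
Notation grid t n := (n.-tupleprod 'I_t).

Lemma grid_leE (t n : nat) (x y : grid t n) :
  (x <= y)%O = [forall i, (tnth x i <= tnth y i)%N].
Proof. by rewrite leEtprod. Qed.

Definition coord_sum (t n : nat) (x : grid t n) : nat :=
  \sum_(i < n) tnth x i.

Definition level (t n k : nat) : {set grid t n} :=
  [set x | coord_sum x == k].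

(* Every nonempty level is the level of one of its elements. *)
Definition max_level_size (t n : nat) : nat :=
  \max_(x : grid t n) #|level t n (coord_sum x)|.

Local Open Scope ring_scope.

(* Since log2 1 = 0 and x / 0 = 0, a condition t < n / (100 * log2 n) with
   0 < t excludes n = 1, where the quotient is undefined. *)
Definition log2 (R : realType) (x : R) : R := ln x / ln 2.

(* Main.v *)
(**
The grid splits into [N] symmetric chains ([N] the largest level), and so do its
images under permutations of the coordinates. If every value occurs many times
among the coordinates of two distinct elements, a random coordinate permutation
puts them into a common chain with probability [O(t / n)]. Cauchy-Schwarz on the
chain sizes then gives supersaturation: [F] contains an element comparable to at
least [m (|F| - N) / N] others in [F], with [m] of order [n / t]. Branching on
such an element, only [O(N log n / m)] steps select it before [F] shrinks to
[(1 + 1/n) N] elements, which bounds the number of antichains by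
[2 ^ (N + O(N t log^2 n / n))]; and [t log^2 n / n] is at most
[(t log^3 n / n) ^ (1/2)] since [t log n <= n]. The elements in which some value
occurs rarely number at most [N / n].
*)

Require Import Defs.
From mathcomp Require Import all_boot all_order all_algebra all_fingroup.
From mathcomp Require Import reals sequences exp.
From mathcomp Require Import zify ring lra.

Set Implicit Arguments.
Unset Strict Implicit.
Unset Printing Implicit Defensive.

Import Order.TTheory GRing.Theory Num.Theory.

(** * Symmetric chain decomposition of the grid *)

(* The least element of the chain of [s] in the symmetric chain decomposition of
   de Bruijn, Tengbergen and Kruyswijk: the chain with bottom [b] occupies the
   ranks from [sumn b] to [size b * t.-1 - sumn b], and its product with
   {0, ..., t - 1} is cut into hooks indexed by the new head of the bottom. *)
Fixpoint chain_bottom (t : nat) (s : seq nat) : seq nat :=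
  if s is v :: s' then
    let b := chain_bottom t s' in
    minn v (size s' * t.-1 - sumn b - sumn s') :: b
  else [::].

Lemma size_chain_bottom t s : size (chain_bottom t s) = size s.
Proof. by elim: s => //= v s ->. Qed.

Lemma chain_bottom_leq t s : sumn (chain_bottom t s) <= sumn s.
Proof. by elim: s => //= v s IH; apply: leq_add => //; apply: geq_minl. Qed.

(** This makes the truncated subtractions in [chain_bottom] exact: the difference there is the
    distance from the tail to the top of its chain. *)
Lemma chain_bottom_top t s : all (ltn^~ t) s ->
  sumn s + sumn (chain_bottom t s) <= size s * t.-1.
Proof. by elim: s => //= v s IH /andP[vt /IH]; lia. Qed.

(** Along a hook the tail climbs first with the head fixed, then the head climbs with the tail
    fixed; so both grow with the total rank. *)
Lemma chain_bottom_monotone t s1 s2 :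
    all (ltn^~ t) s1 -> all (ltn^~ t) s2 ->
    chain_bottom t s1 = chain_bottom t s2 -> sumn s1 <= sumn s2 ->
  all2 leq s1 s2.
Proof.
elim: s1 s2 => [|v s1 IH] [|w s2] //= /andP[vt s1t] /andP[wt s2t] [ev eb] le12.
have sz : size s1 = size s2.
  by rewrite -(size_chain_bottom t) eb size_chain_bottom.
have := chain_bottom_top s1t; have := chain_bottom_top s2t.
have IHs := IH _ s1t s2t eb; rewrite -{}eb -{}sz in ev * => top2 top1.
by rewrite IHs; lia.
Qed.

Lemma chain_bottom_rank t s k :
    all (ltn^~ t) s -> sumn (chain_bottom t s) <= k ->
    k + sumn (chain_bottom t s) <= size s * t.-1 ->
  exists s', [/\ all (ltn^~ t) s', size s' = size s,
                 chain_bottom t s' = chain_bottom t s & sumn s' = k].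
Proof.
elim: s k => [|v s IH] k /= => [_ _|/andP[vt st]].
  by move=> k0; exists [::]; split=> //=; lia.
have top := chain_bottom_top st; have bot := chain_bottom_leq t s.
set b := chain_bottom t s in top bot IH *; set j := minn v _ => lek kle.
have jE : j <= size s * t.-1 - sumn b - sumn s by apply: geq_minr.
have jt : j < t by apply: leq_ltn_trans vt; apply: geq_minl.
(* This rank is the corner of hook [j]: below it the head is [j] and the tail takes up the rank,
   above it the tail stays put and the head takes up the rest. *)
have [small|large] := leqP k (size s * t.-1 - sumn b).
  case: (IH (k - j)) => //; try lia.
  move=> s' [s't sz eb es]; exists (j :: s').
  by split=> /=; rewrite ?jt ?sz ?eb ?es //; [congr (_ :: _); lia | lia].
case: (IH (size s * t.-1 - sumn b - j)) => //; try lia.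
move=> s' [s't sz eb es]; exists (k - sumn s' :: s').
split=> /=; rewrite ?s't ?sz ?eb ?es //; try lia.
by congr (_ :: _); lia.
Qed.

Section Grid.
Variables t n : nat.
Implicit Types x y : grid t n.

Let coords (x : n.-tuple 'I_t) : seq nat := map val x.

Lemma sumn_coords x : sumn (coords x) = coord_sum x.
Proof. by rewrite sumnE big_map big_tuple. Qed.

Lemma coords_lt x : all (ltn^~ t) (coords x).
Proof. by rewrite all_map; apply/allP=> i _ /=. Qed.

Lemma leq_grid_coords x y : all2 leq (coords x) (coords y) -> (x <= y)%O.
Proof.
rewrite grid_leE all2E !size_map !size_tuple eqxx /= => /(all_nthP (0, 0)) le_xy.
apply/forallP => i; have := le_xy i.
rewrite size_zip !size_map !size_tuple minnn nth_zip ?size_map ?size_tuple //=.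
move=> /(_ (ltn_ord i)).
by rewrite /coords !(nth_map (tnth x i)) ?size_tuple // -!tnth_nth.
Qed.

(** The chains are symmetric about the middle rank, so each meets the middle level; the element
    [g x] there names the chain of [x], and one level bounds the number of chains. *)
Lemma chain_centers : exists (g : grid t n -> grid t n) (k : nat),
  (forall x, coord_sum (g x) = k) /\
  (forall x y, g x = g y -> coord_sum x <= coord_sum y -> (x <= y)%O).
Proof.
pose k := (n * t.-1)./2.
have ex x : exists y, (chain_bottom t (coords y) == chain_bottom t (coords x))
    && (coord_sum y == k).
  have top := chain_bottom_top (coords_lt x).
  have bot := chain_bottom_leq t (coords x).
  have szx : size (coords x) = n by rewrite size_map size_tuple.
  case: (@chain_bottom_rank t (coords x) k (coords_lt x)).
  - by rewrite /k; move: bot top; rewrite szx; lia.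
  - by rewrite /k; move: bot top; rewrite szx; lia.
  move=> s [st sz eb es].
  have [y ys] : exists y : n.-tuple 'I_t, coords y = s.
    have szs : size (pmap (insub : nat -> option 'I_t) s) == n.
      by rewrite size_pmap_sub -szx -sz -all_count.
    exists (Tuple szs); rewrite /coords /= (pmap_filter (@insubK _ _ _)).
    rewrite -[RHS](all_filterP st); apply: eq_filter => i /=.
    by case: insubP => [? -> //|/negPf ->].
  by exists y; rewrite -sumn_coords ys eb es !eqxx.
exists (fun x => xchoose (ex x)), k; split=> [x|x y gxy le_xy].
  by have /andP[_ /eqP] := xchooseP (ex x).
apply: leq_grid_coords; apply: (@chain_bottom_monotone t);
  rewrite ?coords_lt ?sumn_coords //.
have /andP[/eqP ex_x _] := xchooseP (ex x).
have /andP[/eqP ex_y _] := xchooseP (ex y).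
by rewrite -ex_x -ex_y gxy.
Qed.

End Grid.

Lemma coord_sum_inj_comparable t n (x y : grid t n) :
  (x <= y)%O -> coord_sum x = coord_sum y -> x = y.
Proof.
rewrite grid_leE => /forallP le_xy eq_sum; apply: eq_from_tnth => i.
apply/val_inj/eqP; have [_] : coord_sum x <= coord_sum y
    ?= iff [forall i, tnth x i == tnth y i :> nat].
  by apply: leqif_sum => j _; apply: leqif_eq (le_xy j).
by rewrite eq_sum eqxx => /esym/forallP/(_ i).
Qed.

(** Cauchy-Schwarz for the sizes [f b] of the fibers of [c] on [F]. *)
Lemma sqr_card_leq_same_fiber (T U : finType) (c : T -> U) (F : {set T})
    (B : {set U}) :
    (forall x, x \in F -> c x \in B) ->
  #|F| ^ 2 <= #|B| * \sum_(x in F) \sum_(y in F) (c x == c y).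
Proof.
move=> cF; pose f b := \sum_(x in F) (c x == b).
have -> : #|F| = \sum_(b in B) f b.
  rewrite /f exchange_big -sum1_card; apply: eq_bigr => x xF /=.
  rewrite (bigD1 (c x)) ?cF //= eqxx big1 // => b /andP[_ /negPf].
  by rewrite eq_sym => ->.
have -> : \sum_(x in F) \sum_(y in F) (c x == c y) = \sum_(b in B) f b ^ 2.
  under [RHS]eq_bigr => b _ do rewrite -mulnn {1}/f big_distrl /=.
  rewrite [RHS]exchange_big; apply: eq_bigr => x xF /=.
  rewrite [RHS](bigD1 (c x)) ?cF //= eqxx mul1n [X in _ + X]big1 ?addn0.
    by apply: eq_bigr => y _; rewrite eq_sym.
  by move=> b /andP[_ /negPf]; rewrite eq_sym => ->.
rewrite -(@leq_pmul2l 2) //.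
have -> : 2 * (#|B| * \sum_(b in B) f b ^ 2)
    = \sum_(a in B) \sum_(b in B) (f a ^ 2 + f b ^ 2).
  under [RHS]eq_bigr => a _ do rewrite big_split /= sum_nat_const.
  by rewrite big_split /= sum_nat_const -big_distrr /= mul2n addnn.
rewrite -mulnn big_distrl big_distrr; apply: leq_sum => a _.
by rewrite /= big_distrr big_distrr; apply: leq_sum => b _; apply: nat_Cauchy.
Qed.

(** * Random permutations of the coordinates *)

Section PermuteCoordinates.
Variables t n : nat.
Implicit Types (x y : grid t n) (s r : 'S_n).

Definition permute s x : grid t n := [tuple tnth x (s i) | i < n].

Lemma tnth_permute s x i : tnth (permute s x) i = tnth x (s i).
Proof. by rewrite tnth_mktuple. Qed.

Lemma permuteM s r x : permute s (permute r x) = permute (s * r)%g x.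
Proof. by apply: eq_from_tnth => i; rewrite !tnth_permute permM. Qed.

Lemma permute_inj s : injective (permute s).
Proof.
move=> x y exy; apply: eq_from_tnth => i.
by rewrite -(permKV s i) -!tnth_permute exy.
Qed.

Lemma coord_sum_permute s x : coord_sum (permute s x) = coord_sum x.
Proof.
rewrite /coord_sum [RHS](reindex_inj (@perm_inj _ s)).
by apply: eq_bigr => i _; rewrite tnth_permute.
Qed.

Lemma permute_le s x y : (permute s x <= permute s y)%O = (x <= y)%O.
Proof.
rewrite !grid_leE; apply/forallP/forallP => le_xy i.
  by have := le_xy ((s^-1)%g i); rewrite !tnth_permute permKV.
by rewrite !tnth_permute.
Qed.

Definition value_class x (a : 'I_t) : {set 'I_n} := [set i | tnth x i == a].

(** The factor 2 allows for halving: if another element is not constant on a value class, it differs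
    on at least [m] coordinates of the class from its value at a suitable one. *)
Definition spread m x := [forall a, 2 * m <= #|value_class x a|].

Section Chains.
Variable g : grid t n -> grid t n.
Hypothesis g_chain :
  forall x y, g x = g y -> coord_sum x <= coord_sum y -> (x <= y)%O.

Lemma same_chain_comparable x y : g x = g y -> (x >=< y)%O.
Proof.
move=> gxy; rewrite /Order.comparable; apply/orP.
by case/orP: (leq_total (coord_sum x) (coord_sum y)) => le_xy;
  [left | right]; apply: g_chain.
Qed.

Lemma same_chain_coord_sum_inj x y : g x = g y -> coord_sum x = coord_sum y -> x = y.
Proof.
by move=> gxy sxy; apply: (coord_sum_inj_comparable _ sxy); apply: g_chain; rewrite ?sxy.
Qed.

(* The transpositions of [i] with the elements of the class of [i] where [y]
   differs from [y i] fix [x] and send [y] to distinct elements of one level;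
   a chain contains at most one of these. *)
Lemma same_chain_count_split m x y i j :
    spread m x -> tnth x i = tnth x j -> tnth y i != tnth y j ->
  #|[set s | g (permute s x) == g (permute s y)]| * m <= n`!.
Proof.
set Pi := [set s | _] => /forallP/(_ (tnth x i)).
set A := value_class x _ => leA xij yij.
have iA : i \in A by rewrite inE.
have jA : j \in A by rewrite inE xij.
(* Since [y] differs at [i] and [j], the coordinates where it differs from one or the other cover
   [A]; so [i] or [j] serves as [k]. *)
have [k kA leD] : exists2 k, k \in A &
    m <= #|[set l in A | tnth y l != tnth y k]|.
  have [|lt_m] := leqP m #|[set l in A | tnth y l != tnth y i]|.
    by exists i.
  exists j => //; rewrite -leq_double -[_.*2]addnn.
  suff : #|A| <= #|[set l in A | tnth y l != tnth y i]| +
                 #|[set l in A | tnth y l != tnth y j]| by lia.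
  apply: leq_trans (leq_card_setU _ _); apply/subset_leq_card/subsetP => l lA.
  rewrite !inE; rewrite inE in lA; rewrite lA /= -negb_and.
  by apply: contra yij => /andP[/eqP <-].
set D := [set l in A | _] in leD.
apply: leq_trans (leq_mul (leqnn _) leD) _.
have fix_x l : l \in A -> permute (tperm k l) x = x.
  rewrite !inE in kA * => /eqP xl; apply: eq_from_tnth => e; rewrite tnth_permute.
  by case: tpermP => // ->; rewrite xl (eqP kA).
have -> : n`! = \sum_(s : 'S_n) 1 by rewrite sum1_card card_Sn.
rewrite mulnC -sum_nat_const.
(* Replacing [s] by [s * tperm k l] leaves the image of [x] alone, so [Pi] is counted once for each
   [l] in [D]; after exchanging the sums, each [s] admits at most one [l]. *)
have cardPi l : l \in D -> #|Pi| =
    \sum_s (g (permute s x) == g (permute (s * tperm k l)%g y)).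
  rewrite inE => /andP[lA _].
  rewrite -sum1_card big_mkcond /= (reindex_inj (mulIg (tperm k l))) /=.
  apply: eq_bigr => s _; rewrite inE -[in X in g X == _]permuteM fix_x //.
rewrite (eq_bigr _ cardPi) exchange_big; apply: leq_sum => s _ /=.
have [/existsP[l /andP[lD /eqP gl]]|/existsPn none] := boolP
    [exists l, (l \in D) && (g (permute s x) == g (permute (s * tperm k l)%g y))];
  last by rewrite big1 // => l lD; have := none l; rewrite lD /= => /negPf ->.
rewrite (bigD1 l) //= gl eqxx big1 // => l' /andP[l'D neq_l].
apply/eqP; rewrite eqb0; apply: contra neq_l => /eqP /same_chain_coord_sum_inj.
rewrite !coord_sum_permute -!permuteM => /(_ erefl) /permute_inj eq_y.
have := congr1 (fun z => tnth z l) eq_y; rewrite !tnth_permute tpermR.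
rewrite !inE in lD l'D; case/andP: lD => _ lD.
case: tpermP => [ek|->//|_ _ eq_k]; first by rewrite ek eqxx in lD.
by rewrite eq_k eqxx in lD.
Qed.

(** A permutation preserves the sum of all values, so none of the inequalities is strict. *)
Lemma inj_leq_id (f : 'I_t -> 'I_t) :
  injective f -> (forall a : 'I_t, a <= f a) -> f =1 id.
Proof.
move=> f_inj le_f a; apply/val_inj/eqP.
have [_] : \sum_(b : 'I_t) (b : nat) <= \sum_(b : 'I_t) (f b : nat)
    ?= iff [forall b : 'I_t, b == f b :> nat].
  by apply: leqif_sum => b _; apply: leqif_eq.
by rewrite [X in X == _](reindex_inj f_inj) eqxx => /esym/forallP/(_ a); rewrite eq_sym.
Qed.

(** If neither element splits a value class of the other, [y] is [x] with its values relabelled by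
    an injective [f]. All values occur, so [x <= y] gives [a <= f a] throughout; then [f] is the
    identity and [x = y]. *)
Lemma same_chain_count_le m x y :
    0 < m -> spread m x -> spread m y -> x != y -> (x <= y)%O ->
  #|[set s | g (permute s x) == g (permute s y)]| * m <= n`!.
Proof.
move=> m0 spx spy neq_xy; rewrite grid_leE => /forallP le_xy.
have [/existsP[i /existsP[j /andP[/eqP xij yij]]]|/existsPn Nx] := boolP
    [exists i, exists j, (tnth x i == tnth x j) && (tnth y i != tnth y j)].
  exact: same_chain_count_split xij yij.
have [/existsP[i /existsP[j /andP[/eqP yij xij]]]|/existsPn Ny] := boolP
    [exists i, exists j, (tnth y i == tnth y j) && (tnth x i != tnth x j)].
  have -> : [set s | g (permute s x) == g (permute s y)] =
      [set s | g (permute s y) == g (permute s x)].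
    by apply/setP => s; rewrite !inE eq_sym.
  exact: same_chain_count_split yij xij.
have ex a : exists i, tnth x i == a.
  have /card_gt0P[i] : 0 < #|value_class x a|.
    by have /forallP/(_ a) := spx; lia.
  by rewrite inE; exists i.
pose f a := tnth y (xchoose (ex a)).
have f_x i : f (tnth x i) = tnth y i.
  have := xchooseP (ex (tnth x i)) => /eqP ei; apply/eqP.
  by have /existsPn/(_ i) := Nx (xchoose (ex (tnth x i))); rewrite ei eqxx negbK.
have f_id : f =1 id.
  apply: inj_leq_id => [a b|a]; last first.
    by have /eqP {1}<- := xchooseP (ex a); apply: le_xy.
  have /eqP {1}<- := xchooseP (ex a); have /eqP {1}<- := xchooseP (ex b).
  rewrite !f_x => eq_y; apply/eqP.
  have /existsPn/(_ (xchoose (ex b))) := Ny (xchoose (ex a)).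
  rewrite eq_y eqxx /= negbK.
  by rewrite (eqP (xchooseP (ex a))) (eqP (xchooseP (ex b))).
case/eqP: neq_xy; apply: eq_from_tnth => i.
by rewrite -f_x f_id.
Qed.

(** For a uniformly random [s], the probability of a common chain is at most [1 / m], and zero for
    incomparable pairs, as permutations preserve the order. *)
Lemma same_chain_count m x y :
    0 < m -> spread m x -> spread m y -> x != y ->
  #|[set s | g (permute s x) == g (permute s y)]| * m <= (x >=< y)%O * n`!.
Proof.
move=> m0 spx spy neq_xy; case: (boolP (x >=< y)%O) => [/orP[le_xy|le_yx]|].
- by rewrite mul1n same_chain_count_le.
- rewrite mul1n; under eq_finset => s do rewrite eq_sym.
  by rewrite same_chain_count_le // eq_sym.
move=> nxy; rewrite leqn0 muln_eq0 cards_eq0; apply/orP; left.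
apply/eqP/setP => s; rewrite !inE; apply: contraNF nxy => /eqP/same_chain_comparable.
by rewrite /Order.comparable !permute_le.
Qed.

End Chains.
End PermuteCoordinates.

(** * Counting independent sets by containers *)

Section Containers.
Variables (T : finType) (e : rel T).

(** Allowing [x == y] lets [e] be reflexive; for comparability this unfolds to [antichain]. *)
Definition independent (A : {set T}) :=
  [forall x in A, forall y in A, e x y ==> (x == y)].

Definition num_independent (F : {set T}) :=
  #|[set A in powerset F | independent A]|.

Definition degree (F : {set T}) v := #|[set y in F | (v != y) && e v y]|.

Lemma num_independent_le (F : {set T}) : num_independent F <= 2 ^ #|F|.
Proof.
rewrite -card_powerset; apply/subset_leq_card/subsetP => A.
by rewrite inE => /andP[].
Qed.

Lemma num_independentU (F G : {set T}) :
  num_independent (F :|: G) <= num_independent F * 2 ^ #|G|.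
Proof.
rewrite /num_independent -card_powerset -cardsX.
pose f (A : {set T}) := (A :&: F, A :&: G).
rewrite -(@card_in_imset _ _ f).
  apply/subset_leq_card/subsetP => _ /imsetP[A + ->].
  rewrite !inE => /andP[_ /forall_inP indA] /=; rewrite !subsetIr /= andbT.
  apply/forall_inP => x /setIP[xA _]; apply/forall_inP => y /setIP[yA _].
  exact: (forall_inP (indA x xA)).
move=> A B; rewrite !inE => /andP[/setIidPl sA _] /andP[/setIidPl sB _] [eF eG].
by rewrite -sA -sB !setIUr eF eG.
Qed.

Lemma num_independent_split (F : {set T}) v : v \in F ->
  num_independent F <= num_independent (F :\ v) +
    num_independent (F :\ v :\: [set y in F | (v != y) && e v y]).
Proof.
move=> vF; set D := [set y in F | _].
rewrite /num_independent -(cardsID [set A : {set T} | v \in A]) addnC.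
apply: leq_add.
  apply/subset_leq_card/subsetP => A; rewrite !inE => /and3P[nvA sAF ->].
  by rewrite subsetD1 sAF nvA.
rewrite -(@card_in_imset _ _ (fun A : {set T} => A :\ v)); last first.
  move=> A B; rewrite !inE => /andP[_ vA] /andP[_ vB] eAB.
  by rewrite -(setD1K vA) eAB setD1K.
apply/subset_leq_card/subsetP => _ /imsetP[A + ->].
rewrite !inE => /andP[/andP[sAF /forall_inP indA] vA]; apply/andP; split.
  apply/subsetP => y /setD1P[neq_y yA]; rewrite !inE neq_y (subsetP sAF) //=.
  rewrite andbT [v == y]eq_sym neq_y /=.
  apply: contra neq_y => evy; rewrite eq_sym.
  exact: implyP (forall_inP (indA v vA) y yA) evy.
apply/forall_inP => x /setD1P[_ xA]; apply/forall_inP => y /setD1P[_ yA].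
exact: (forall_inP (indA x xA)).
Qed.

Local Open Scope ring_scope.

(* If the excess [#|F| - N] shrinks by the factor [1 - delta] whenever the
   vertex of large degree is put into the independent set, at most [q] such
   steps occur before [#|F| <= N + K]; each is paid for by a factor
   [lambda^-1], and each vertex by a factor [1 + lambda]. *)
Lemma container_count (R : realType) (N K q : nat) (delta lambda : R)
    (F : {set T}) :
    0 < lambda <= 1 -> 0 <= delta <= 1 ->
    (forall F' : {set T}, F' \subset F -> (N < #|F'|)%N ->
       exists2 v, v \in F' & delta * (#|F'|%:R - N%:R) <= (degree F' v)%:R) ->
    (#|F|%:R - N%:R) * (1 - delta) ^+ q <= K%:R ->
  (num_independent F)%:R <= 2 ^+ (N + K) * (1 + lambda) ^+ #|F| / lambda ^+ q.
Proof.
move=> /andP[l0 l1] /andP[d0 d1].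
elim: {F}_.+1 {-2}F q (ltnSn #|F|) => // M IH F q ltFM supersat excess.
have [small|large] := leqP #|F| (N + K).
  rewrite -mulrA; apply: le_trans (_ : 2 ^+ (N + K) <= _).
    rewrite -natrX ler_nat; apply: leq_trans (num_independent_le F) _.
    by rewrite leq_exp2l.
  rewrite ler_peMr ?exprn_ge0 // mulr_ege1 ?exprn_ege1 ?lerDl ?(ltW l0) //.
  by rewrite invf_ge1 ?exprn_gt0 // exprn_ile1 // ltW.
case: q excess => [|q] excess.
  move: excess; rewrite expr0 mulr1 lerBlDr -natrD ler_nat; lia.
have [|v vF leD] := supersat F (subxx _); first by lia.
set D := [set y in F | (v != y) && e v y].
have cardF1 : #|F| = #|F :\ v|.+1 by rewrite (cardsD1 v F) vF.
have sDF : D \subset F :\ v.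
  by apply/subsetP => y; rewrite !inE => /and3P[-> nvy _]; rewrite eq_sym nvy.
have cardFD : (#|F :\ v :\: D| + degree F v)%N = #|F :\ v|.
  by rewrite -(cardsID D (F :\ v)) (setIidPr sDF) addnC.
have sub1 : F :\ v \subset F by apply: subD1set.
have sub2 : F :\ v :\: D \subset F by apply: subset_trans sub1; apply: subsetDl.
have step1 : (num_independent (F :\ v))%:R <=
    2 ^+ (N + K) * (1 + lambda) ^+ #|F :\ v| / lambda ^+ q.+1 :> R.
  apply: IH; first by lia.
    by move=> F' sF'; apply: supersat; apply: subset_trans sF' sub1.
  apply: le_trans excess; rewrite ler_wpM2r ?exprn_ge0 ?subr_ge0 //.
  by rewrite lerD2r ler_nat cardF1.
have step2 : (num_independent (F :\ v :\: D))%:R <=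
    2 ^+ (N + K) * (1 + lambda) ^+ #|F :\ v| / lambda ^+ q :> R.
  apply: (@le_trans _ _ (2 ^+ (N + K) * (1 + lambda) ^+ #|F :\ v :\: D| / lambda ^+ q)).
    apply: IH; first by lia.
      by move=> F' sF'; apply: supersat; apply: subset_trans sF' sub2.
    apply: le_trans excess; rewrite exprS mulrA.
    rewrite ler_wpM2r ?exprn_ge0 ?subr_ge0 //.
    have : #|F|%:R = #|F :\ v :\: D|%:R + (degree F v)%:R + 1 :> R.
      by rewrite cardF1 -cardFD -natr1 natrD.
    by move: leD; lra.
  rewrite ler_wpM2r ?invr_ge0 ?exprn_ge0 ?(ltW l0) //.
  rewrite ler_wpM2l ?exprn_ge0 // ler_weXn2l ?lerDl ?ltW //.
  by rewrite -cardFD leq_addr.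
apply: le_trans (_ : (num_independent (F :\ v))%:R +
    (num_independent (F :\ v :\: D))%:R <= _).
  by rewrite -natrD ler_nat num_independent_split.
apply: le_trans (lerD step1 step2) _.
(* Equality holds, as [lambda^-(q+1) + lambda^-q = (1 + lambda) * lambda^-(q+1)]. *)
rewrite cardF1 le_eqVlt; apply/orP; left; apply/eqP.
have lq0 : lambda ^+ q != 0 by rewrite expf_neq0 // gt_eqF.
rewrite !exprS; field.
by rewrite ?lq0 gt_eqF.
Qed.

End Containers.

(** * Sizes of levels and of the grid *)

Lemma level_leq_max t n (x : grid t n) k :
  coord_sum x = k -> #|level t n k| <= max_level_size t n.
Proof. by move=> <-; apply: (leq_bigmax x). Qed.

Lemma coord_sum_leq t n (x : grid t n) : coord_sum x <= n * t.-1.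
Proof.
rewrite -[n in n * _]card_ord -sum_nat_const; apply: leq_sum => i _.
by have := ltn_ord (tnth x i); lia.
Qed.

Lemma card_grid t n : #|{: grid t n}| = t ^ n.
Proof. by rewrite card_tuple card_ord. Qed.

(** Pigeonhole over the coordinate sums from 0 to [n * t.-1]. A polynomial loss is harmless, as the
    later parameters cancel powers of [n]. *)
Lemma card_grid_leq t n : t ^ n <= (n * t.-1).+1 * max_level_size t n.
Proof.
rewrite -card_grid -sum1_card.
pose lev (x : grid t n) : 'I_(n * t.-1).+1 := inord (coord_sum x).
rewrite (partition_big lev xpredT) //= -[X in _ <= X * _]card_ord -sum_nat_const.
apply: leq_sum => k _; rewrite sum1_card.
have [x xk|none] := pickP [pred x | lev x == k].
  apply: leq_trans (level_leq_max (erefl (coord_sum x))).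
  apply/subset_leq_card/subsetP => y yk; rewrite inE.
  have : lev y = lev x by rewrite (eqP xk); apply/eqP.
  move=> /(congr1 val).
  by rewrite /= !inordK ?ltnS ?coord_sum_leq // => ->.
by rewrite eq_card0.
Qed.

(** The level of sum 1 contains [n] unit vectors. This will keep [N %/ n] positive and [m <= n]
    below the largest level size. *)
Lemma leq_max_level t n : 1 < t -> n <= max_level_size t n.
Proof.
case: t => [|[|t]] // _.
pose u (i : 'I_n) : grid t.+2 n := [tuple inord (j == i) | j < n].
have su i : coord_sum (u i) = 1.
  rewrite /coord_sum (bigD1 i) //= big1 ?addn0 => [|j /negPf ji];
  by rewrite tnth_mktuple inordK ?eqxx ?ji.
have u_inj : injective u.
  move=> i j uij; have : tnth (u i) i = tnth (u j) i :> nat by rewrite uij.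
  rewrite !tnth_mktuple eqxx !inordK //; last by case: (i == j).
  by case: eqP.
case: n u su u_inj => [|n] u su u_inj //.
apply: leq_trans (level_leq_max (su ord0)).
rewrite -[X in X <= _]card_ord -(card_imset _ u_inj).
by apply/subset_leq_card/subsetP => _ /imsetP[i _ ->]; rewrite inE su.
Qed.

(** * Supersaturation *)

(** Cauchy-Schwarz for the chains permuted by [s], summed over [s]. Diagonal pairs share a chain for
    every [s], other comparable pairs for at most a fraction [1 / m], incomparable ones never. *)
Lemma supersaturation_sum t n m (F : {set grid t n}) :
    0 < m -> (forall x, x \in F -> spread m x) ->
  m * #|F| ^ 2 <= max_level_size t n *
    (m * #|F| + \sum_(x in F) degree (fun x y => (x >=< y)%O) F x).
Proof.
move=> m0 spF.
have [g [k [gk g_chain]]] := chain_centers t n.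
have [->|[z zF]] := set_0Vmem F; first by rewrite cards0 exp0n // muln0.
have levelk : #|level t n k| <= max_level_size t n by apply: (level_leq_max (gk z)).
rewrite -(@leq_pmul2l n`!) ?fact_gt0 //.
have -> : n`! * (m * #|F| ^ 2) = \sum_(s : 'S_n) m * #|F| ^ 2.
  by rewrite sum_nat_const card_Sn.
apply: (@leq_trans (\sum_(s : 'S_n) m * (max_level_size t n *
    \sum_(x in F) \sum_(y in F) (g (permute s x) == g (permute s y))))).
  apply: leq_sum => s _; rewrite leq_mul2l; apply/orP; right.
  apply: leq_trans (leq_mul levelk (leqnn _)).
  by apply: (sqr_card_leq_same_fiber (c := fun x => g (permute s x))) => x _;
    rewrite inE gk.
rewrite -!big_distrr /= exchange_big /= mulnCA [X in _ <= X]mulnCA.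
rewrite leq_mul2l; apply/orP; right.
have -> : n`! * (m * #|F| + \sum_(x in F) degree (fun x y => (x >=< y)%O) F x) =
    \sum_(x in F) (n`! * m + n`! * degree (fun x y => (x >=< y)%O) F x).
  rewrite big_split /= sum_nat_const -big_distrr /= mulnDr.
  by congr (_ + _); rewrite mulnA mulnC.
rewrite big_distrr /=.
apply: leq_sum => x xF; rewrite exchange_big /= (bigD1 x) //= mulnDr.
apply: leq_add.
  under eq_bigr => s _ do rewrite eqxx.
  by rewrite sum_nat_const card_Sn muln1 mulnC.
rewrite /degree -sum1_card big_distrr.
rewrite [X in _ <= X]big_distrr.
rewrite [X in _ <= X](eq_bigl
  (fun y => (y \in F) && (y != x) && (x >=< y)%O)); last first.
  by move=> y; rewrite !inE eq_sym andbA.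
rewrite [X in _ <= X]big_mkcondr /=; apply: leq_sum => y /andP[yF neq_yx].
have := @same_chain_count t n g g_chain m x y m0 (spF x xF) (spF y yF).
rewrite eq_sym neq_yx => /(_ isT).
rewrite mulnC; congr (_ * _ <= _).
  by rewrite -sum1_card big_mkcond; apply: eq_bigr => s _; rewrite inE; case: eqP.
by case: (_ >=< _)%O; rewrite ?mul1n ?muln1.
Qed.

Lemma supersaturation t n m (F : {set grid t n}) :
    0 < m -> (forall x, x \in F -> spread m x) -> max_level_size t n < #|F| ->
  exists2 v, v \in F & m * (#|F| - max_level_size t n) <=
    max_level_size t n * degree (fun x y => (x >=< y)%O) F v.
Proof.
move=> m0 spF ltF; set N := max_level_size t n in ltF *.
have sat := supersaturation_sum m0 spF; rewrite -/N in sat.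
apply/exists_inP; apply: contraTT sat => /exists_inPn small.
rewrite -ltnNge -mulnn mulnDr big_distrr /=.
have -> : m * (#|F| * #|F|) = N * (m * #|F|) + \sum_(x in F) m * (#|F| - N).
  by rewrite sum_nat_const; nia.
have /card_gt0P[v vF] : 0 < #|F| by lia.
rewrite ltn_add2l (bigD1 v) //= [X in _ < X](bigD1 v) //= -addSn.
apply: leq_add; first by rewrite ltnNge small.
by apply: leq_sum => x /andP[xF _]; rewrite ltnW // ltnNge small.
Qed.

(** * Elements in which some value is rare *)

(** The weight factors over coordinates, with 1 for the value [a] and 2 for each of the [t - 1]
    others. *)
Lemma sum_pow_value_class t n (a : 'I_t) :
  \sum_(x : grid t n) 2 ^ #|~: value_class x a| = (2 * t).-1 ^ n.
Proof.
have -> : (2 * t).-1 = \sum_(b : 'I_t) (if b == a then 1 else 2).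
  have sum2 : \sum_(b : 'I_t) 2 = 2 * t by rewrite sum_nat_const card_ord mulnC.
  rewrite -sum2 (bigD1 a) //= [RHS](bigD1 a) //= eqxx.
  by congr (_ + _); apply: eq_bigr => b /negPf ->.
rewrite -[X in _ = _ ^ X]card_ord -[RHS]prod_nat_const bigA_distr_bigA /=.
rewrite (reindex (fun f : {ffun 'I_n -> 'I_t} => [tuple f i | i < n] : grid t n)) /=.
  apply: eq_bigr => f _; rewrite -prod_nat_const big_mkcond /=.
  by apply: eq_bigr => i _; rewrite !inE tnth_mktuple; case: eqP.
exists (fun x : grid t n => [ffun i => tnth x i]) => [f|x] _.
  by apply/ffunP => i; rewrite ffunE tnth_mktuple.
by apply: eq_from_tnth => i; rewrite tnth_mktuple ffunE.
Qed.

(** Exponential Markov inequality: an [x] counted here has weight at least [2 ^ (n - h)] in the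
    preceding sum. *)
Lemma card_small_value_class t n h (a : 'I_t) :
  #|[set x : grid t n | #|value_class x a| < h]| * 2 ^ n <=
    2 ^ h * (2 * t).-1 ^ n.
Proof.
rewrite -(sum_pow_value_class n a) -sum_nat_const big_mkcond big_distrr /=.
apply: leq_sum => x _; rewrite inE; case: ifP => // lt_h.
rewrite -expnD leq_exp2l //.
have := cardsC (value_class x a); rewrite card_ord => cardn.
by rewrite -[X in X <= _]cardn leq_add2r ltnW.
Qed.

Lemma card_not_spread t n m :
  #|[set x : grid t n | ~~ spread m x]| * 2 ^ n <=
    t * (2 ^ (2 * m) * (2 * t).-1 ^ n).
Proof.
have -> k : t * k = \sum_(a : 'I_t) k by rewrite sum_nat_const card_ord.
apply: (@leq_trans (\sum_(a : 'I_t)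
    #|[set x : grid t n | #|value_class x a| < 2 * m]| * 2 ^ n)); last first.
  by apply: leq_sum => a _; apply: card_small_value_class.
rewrite -big_distrl /= leq_mul2r; apply/orP; right.
have -> : [set x : grid t n | ~~ spread m x] =
    \bigcup_a [set x : grid t n | #|value_class x a| < 2 * m].
  apply/setP => x; rewrite inE; apply/forallPn/bigcupP => -[a].
    by rewrite -ltnNge; exists a; rewrite ?inE.
  by rewrite inE ltnNge; exists a.
apply: (big_ind2 (fun (A : {set grid t n}) k => #|A| <= k)) => [|A k B l leA leB|//].
  by rewrite cards0.
exact: leq_trans (leq_card_setU A B) (leq_add leA leB).
Qed.

(** * Choice of parameters and the final estimate *)

Local Open Scope ring_scope.

(** Containers are used on the spread elements only, where supersaturation holds with
    [delta = m / N]; each other element costs a factor 2. *)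
Lemma num_antichains_container (R : realType) t n m q K (lambda : R) :
    (0 < m <= max_level_size t n)%N -> 0 < lambda <= 1 ->
    (t ^ n)%:R * (1 - m%:R / (max_level_size t n)%:R) ^+ q <= K%:R :> R ->
  (num_antichains (grid t n))%:R <=
    2 ^+ (max_level_size t n + K + #|[set x : grid t n | ~~ spread m x]|) *
      (1 + lambda) ^+ (t ^ n) / lambda ^+ q.
Proof.
set N := max_level_size t n; set B := [set x | _] => /andP[m0 mN] lambda01 excess.
pose comp (x y : grid t n) := (x >=< y)%O.
have N0 : (0 : R) < N%:R by rewrite ltr0n; lia.
have delta01 : 0 <= (m%:R / N%:R : R) <= 1.
  by apply/andP; split; [apply: divr_ge0 | rewrite ler_pdivrMr ?mul1r ?ler_nat].
have cardC : (#|~: B| <= t ^ n)%N by rewrite -card_grid max_card.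
have count : (num_independent comp (~: B))%:R <=
    2 ^+ (N + K) * (1 + lambda) ^+ #|~: B| / lambda ^+ q.
  apply: (container_count (delta := m%:R / N%:R)) => //.
    move=> F /subsetP sF ltF.
    have spF x : x \in F -> spread m x by move=> /sF; rewrite !inE negbK.
    have [v vF] := supersaturation m0 spF ltF; exists v => //.
    rewrite -mulrAC ler_pdivrMr // -natrB ?(ltnW ltF) // -!natrM ler_nat.
    by rewrite [X in (_ <= X)%N]mulnC.
  apply: le_trans excess; rewrite ler_wpM2r ?exprn_ge0 ?subr_ge0 //.
    by case/andP: delta01.
  rewrite lerBlDr -natrD ler_nat; exact: leq_trans cardC (leq_addr _ _).
have : (num_antichains (grid t n) <= num_independent comp (~: B) * 2 ^ #|B|)%N.
  apply: leq_trans (num_independentU _ _ _); apply/subset_leq_card/subsetP => A.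
  by rewrite !inE setUC setUCr subsetT.
rewrite -(ler_nat R) natrM natrX => /le_trans; apply.
case/andP: lambda01 => l0 l1.
rewrite exprD; apply: le_trans (ler_wpM2r _ count) _; first exact: exprn_ge0.
rewrite [X in X <= _]mulrC [X in _ <= X * _ / _]mulrC -!mulrA.
rewrite ler_wpM2l ?exprn_ge0 // ler_wpM2l ?exprn_ge0 //.
rewrite ler_wpM2r ?invr_ge0 ?exprn_ge0 ?(ltW l0) //.
by rewrite ler_weXn2l // lerDl ltW.
Qed.

Lemma ln2_bounds (R : realType) : 2^-1 <= (ln 2 : R) <= 1.
Proof.
apply/andP; split; last by have := @le_ln1Dx R 1; rewrite -[1 + 1]/(2%:R); apply; lra.
have := @le_ln1Dx R (- 2^-1).
have -> : 1 + - 2^-1 = 2^-1 :> R by lra.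
by rewrite lnV ?posrE //; lra.
Qed.

Lemma expr_1subr_le (R : realType) (x : R) k :
  x <= 1 -> (1 - x) ^+ k <= expR (- (x * k%:R)).
Proof.
move=> x1; rewrite -mulNr expRM_natr lerXn2r ?nnegrE ?subr_ge0 ?expR_ge0 //.
exact: expR_ge1Dx.
Qed.

Lemma expR_ln_nat (R : realType) k n : (0 < n)%N ->
  expR (- (k%:R * ln n%:R)) = (n%:R ^+ k)^-1 :> R.
Proof. by move=> n0; rewrite expRN expRM_natl lnK // posrE ltr0n. Qed.

Lemma card_grid_le_width t n : (0 < t)%N -> (0 < n)%N ->
  (t ^ n <= n * t * max_level_size t n)%N.
Proof.
move=> t0 n0; apply: leq_trans (card_grid_leq t n) _.
by rewrite leq_mul2r; apply/orP; right; nia.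
Qed.

(** The hypothesis bounds [2 ^ (2 * m) * (1 - 1 / (2 * t)) ^ n] by [n ^ -4]. Of these powers
    [t <= n] uses one and [t ^ n <= n ^ 2 * N] two, which leaves [N / n]. *)
Lemma card_not_spread_le (R : realType) t n m :
    (0 < t <= n)%N ->
    (2 * m)%:R + 4 * ln (n%:R : R) <= n%:R / (2 * t%:R) ->
  (#|[set x : grid t n | ~~ spread m x]| * n <= max_level_size t n)%N.
Proof.
move=> /andP[t0 tn]; set B := [set x | _]; set N := max_level_size t n => le_m.
have n0 : (0 < n)%N := leq_trans t0 tn.
have tR : (0 : R) < t%:R by rewrite ltr0n.
have nR : (0 : R) < n%:R by rewrite ltr0n.
have decay : 2 ^+ (2 * m) * (1 - (2 * t%:R)^-1) ^+ n <= (n%:R ^+ 4)^-1 :> R.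
  have two_le : 2 <= expR 1 :> R by have := @expR_ge1Dx R 1; lra.
  have le2 : 2 ^+ (2 * m) <= expR (2 * m)%:R :> R.
    by rewrite -[(2 * m)%:R]mul1r expRM_natr lerXn2r ?nnegrE // expR_ge0.
  have t1 : (1 : R) <= t%:R by rewrite ler1n.
  have le1 : (2 * t%:R)^-1 <= 1 :> R by rewrite invf_le1; lra.
  apply: le_trans (ler_pM _ _ le2 (expr_1subr_le n le1)) _.
  - by rewrite exprn_ge0.
  - by rewrite exprn_ge0 // subr_ge0.
  rewrite -expRD -expR_ln_nat // ler_expR.
  by move: le_m; rewrite [n%:R / _]mulrC; lra.
have cardB : #|B|%:R <=
    t%:R * (2 ^+ (2 * m) * (1 - (2 * t%:R)^-1) ^+ n) * (t ^ n)%:R :> R.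
  have := card_not_spread t n m; rewrite -/B -(ler_nat R) !natrM !natrX.
  rewrite -ler_pdivlMr ?exprn_gt0 // => /le_trans; apply.
  have -> : (2 * t).-1%:R = (1 - (2 * t%:R)^-1) * (2 * t%:R) :> R.
    rewrite mulrBl mul1r mulVf ?mulf_neq0 ?gt_eqF //.
    by rewrite -subn1 natrB ?natrM //; lia.
  rewrite !exprMn le_eqVlt; apply/orP; left; apply/eqP; field.
  by rewrite expf_neq0 // pnatr_eq0.
rewrite -(ler_nat R) natrM -ler_pdivlMr //; apply: le_trans cardB _.
have cardG : (t ^ n)%:R <= n%:R * n%:R * N%:R :> R.
  rewrite -!natrM ler_nat; apply: leq_trans (card_grid_le_width t0 n0) _.
  by rewrite leq_mul2r leq_mul2l tn !orbT.
have tnR : t%:R <= n%:R :> R by rewrite ler_nat.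
have pos : 0 <= 2 ^+ (2 * m) * (1 - (2 * t%:R)^-1) ^+ n :> R.
  rewrite mulr_ge0 ?exprn_ge0 // subr_ge0 invf_le1 ?mulr_gt0 //.
  by have : (1 : R) <= t%:R by [rewrite ler1n]; lra.
apply: le_trans (ler_pM _ _ (ler_pM _ _ tnR decay) cardG) _ => //.
  by rewrite mulr_ge0 // ltW.
rewrite le_eqVlt; apply/orP; left; apply/eqP; field.
by rewrite gt_eqF.
Qed.

Lemma log2_num_antichains_le (R : realType) t n (L : R) :
    (1 < t)%N -> (1 < n)%N -> L = log2 n%:R -> 100 * L * t%:R < n%:R ->
  log2 (num_antichains (grid t n))%:R <=
    (1 + 484 * (t%:R * L ^+ 2 / n%:R)) * (max_level_size t n)%:R.
Proof.
move=> t1 n1 LE Ltn; set N := max_level_size t n; set l := ln (n%:R : R).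
have n_gt0 := ltnW n1; have t_gt0 := ltnW t1.
have n0 : (0 : R) < n%:R by rewrite ltr0n.
have t0 : (0 : R) < t%:R by rewrite ltr0n.
have nN : (n <= N)%N by apply: leq_max_level.
have N0 : (0 : R) < N%:R by rewrite ltr0n (leq_trans n_gt0).
have /andP[ln2_ge ln2_le] := ln2_bounds R.
have ln2_gt0 : 0 < ln 2 :> R by lra.
have lE : l = L * ln 2 by rewrite LE /log2 divfK // gt_eqF.
have L1 : 1 <= L.
  rewrite LE /log2 ler_pdivlMr // mul1r ler_ln ?posrE ?ltr0n ?ler_nat // (leq_trans _ n1).
have lL : l <= L by rewrite lE ler_piMr //; lra.
have l_ge : 2^-1 <= l.
  by rewrite lE; apply: le_trans ln2_ge _; rewrite ler_peMl // ltW.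
have t100 : 100 * t%:R <= n%:R :> R.
  by apply: le_trans (ltW Ltn); rewrite ler_wpM2r ?(ltW t0) //; lra.
have tn : (t <= n)%N by rewrite -(ler_nat R); lra.
(* Small enough for [2 * m + 4 * ln n <= n / (2 * t)], yet positive since [100 * t <= n]. *)
pose m := (n %/ (16 * t))%N.
have mE : (m * (16 * t) <= n < m.+1 * (16 * t))%N.
  by rewrite leq_divM ltn_ceil // muln_gt0.
have m_le : (m%:R * (16 * t%:R) : R) <= n%:R.
  by have /andP[+ _] := mE; rewrite -(ler_nat R) !natrM.
have m_gt : (n%:R : R) < (m%:R + 1) * (16 * t%:R).
  by have /andP[_ +] := mE; rewrite -(ltr_nat R) !natrM -natr1.
have m_ge1 : (1 : R) <= m%:R.
  by rewrite ler1n lt0n; apply: contraTneq m_gt => ->; rewrite -leNgt; lra.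
have m_ge : n%:R <= m%:R * (32 * t%:R) :> R.
  by have : t%:R <= m%:R * t%:R :> R by [rewrite ler_peMl // ltW]; lra.
have m0 : (0 : R) < m%:R by lra.
have mn : (m <= n)%N by rewrite /m leq_div.
pose K := (N %/ n)%N.
have K_le : (K * n <= N)%N by rewrite leq_divM.
have K_ge1 : (0 < K)%N by rewrite divn_gt0.
have K_gt : (N < K.+1 * n)%N by rewrite ltn_ceil.
(* This many steps give [(1 - m / N) ^ q <= n ^ -4], bringing the excess from at most [n ^ 2 * N]
   down to [N / n ^ 2 <= K]. *)
pose q := (Num.truncn (4 * l * N%:R / m%:R)).+1.
have x0 : 0 <= 4 * l * N%:R / m%:R by rewrite !mulr_ge0 ?invr_ge0 //; lra.
have /andP[q_le q_gt] := truncn_itv x0; rewrite -/q in q_gt.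
have mN : m%:R <= N%:R :> R by rewrite ler_nat (leq_trans mn).
have q_up : q%:R * n%:R <= 160 * (L * t%:R * N%:R).
  have q_up : q%:R * m%:R <= 4 * l * N%:R + m%:R.
    by rewrite /q -natr1 mulrDl mul1r lerD2r -ler_pdivlMr.
  have lN : l * N%:R <= L * N%:R by rewrite ler_wpM2r.
  have LN : N%:R <= L * N%:R by rewrite ler_peMl.
  have qm : q%:R * m%:R <= 5 * (L * N%:R) by lra.
  apply: le_trans (ler_wpM2l _ m_ge) _ => //.
  have t32 : 0 <= 32 * t%:R :> R by lra.
  by have := ler_wpM2r t32 qm; lra.
have cardG : (t ^ n)%:R <= n%:R * n%:R * N%:R :> R.
  rewrite -!natrM ler_nat; apply: leq_trans (card_grid_le_width t_gt0 n_gt0) _.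
  by rewrite leq_mul2r leq_mul2l tn !orbT.
have excess : (t ^ n)%:R * (1 - m%:R / N%:R) ^+ q <= K%:R :> R.
  have d1 : m%:R / N%:R <= 1 :> R by rewrite ler_pdivrMr // mul1r.
  have decay : (1 - m%:R / N%:R) ^+ q <= (n%:R ^+ 4)^-1 :> R.
    apply: le_trans (expr_1subr_le q d1) _; rewrite -expR_ln_nat ?ler_expR //.
    rewrite lerN2 -/l mulrAC ler_pdivlMr // [m%:R * _]mulrC -ler_pdivrMr //.
    exact: ltW.
  apply: le_trans (ler_pM _ _ cardG decay) _ => //.
    by rewrite exprn_ge0 // subr_ge0.
  have -> : n%:R * n%:R * N%:R / n%:R ^+ 4 = N%:R / n%:R ^+ 2 :> R.
    by field; rewrite gt_eqF.
  rewrite ler_pdivrMr ?exprn_gt0 // -natrX -natrM ler_nat.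
  apply: leq_trans (ltnW K_gt) _; rewrite expnS expn1 mulnA leq_mul2r.
  apply/orP; right; apply: (@leq_trans (K * 2)).
    by rewrite muln2 -addnn -addn1 leq_add2l.
  by rewrite leq_mul2l n1 orbT.
have bad := @card_not_spread_le R t n m.
have {}bad : (#|[set x : grid t n | ~~ spread m x]| * n <= N)%N.
  apply: bad; first by rewrite t_gt0.
  have lt : l * t%:R <= L * t%:R by rewrite ler_wpM2r // ltW.
  by clear excess; rewrite ler_pdivlMr ?mulr_gt0 // natrM -/l; lra.
set B := #|_| in bad.
(* With [lambda = n ^ -3], the factor [(1 + lambda) ^ (t ^ n)] adds at most [N / n] to the
   logarithm, and each of the [q] steps adds [3 * ln n]. *)
have lambda01 : 0 < ((n%:R ^+ 3)^-1 : R) <= 1.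
  rewrite invr_gt0 exprn_gt0 //= invf_le1 ?exprn_gt0 //.
  by rewrite exprn_ege1 // ler1n.
have m01 : (0 < m <= N)%N by rewrite -(ltr0n R) m0 (leq_trans mn).
have := num_antichains_container m01 lambda01 excess; rewrite -/N -/B {excess}.
set lambda := (n%:R ^+ 3)^-1 in lambda01 *; case/andP: lambda01 => lambda0 lambda1.
have a0 : 0 < (num_antichains (grid t n))%:R :> R.
  rewrite ltr0n; apply/card_gt0P; exists set0; rewrite inE.
  by apply/forall_inP => x; rewrite inE.
have lambda1D : 0 < 1 + lambda by rewrite addr_gt0.
have p2 k : 0 < 2 ^+ k :> R by rewrite exprn_gt0.
have p1 k : 0 < (1 + lambda) ^+ k by rewrite exprn_gt0.
rewrite -exprVn invrK -exprM => count.
have pn k : 0 < n%:R ^+ k :> R by rewrite exprn_gt0.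
have : ln (num_antichains (grid t n))%:R <=
    (N + K + B)%:R * ln 2 + (t ^ n)%:R * lambda + (3 * q)%:R * l.
  apply: (@le_trans _ _ (ln (2 ^+ (N + K + B) *
      (1 + lambda) ^+ (t ^ n) * n%:R ^+ (3 * q)))).
    by rewrite ler_ln ?posrE // !mulr_gt0.
  rewrite !lnM ?posrE ?mulr_gt0 // !lnXn //.
  rewrite -(mulr_natl (ln 2)) -(mulr_natl (ln (1 + lambda))) -(mulr_natl (ln n%:R)).
  rewrite lerD2r lerD2l.
  by rewrite ler_wpM2l // le_ln1Dx // (lt_trans _ lambda0) // ltrN10.
have lambda_n : (t ^ n)%:R * lambda * n%:R <= N%:R.
  apply: le_trans (ler_wpM2r (ltW n0) (ler_wpM2r (ltW lambda0) cardG)) _.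
  by rewrite le_eqVlt; apply/orP; left; apply/eqP; rewrite /lambda; field; rewrite gt_eqF.
move=> {count} ln_le; rewrite /log2 ler_pdivrMr //; apply: le_trans ln_le _.
rewrite -(ler_pM2r n0).
have -> : (1 + 484 * (t%:R * L ^+ 2 / n%:R)) * N%:R * ln 2 * n%:R =
    (n%:R + 484 * (t%:R * L ^+ 2)) * N%:R * ln 2 by field; rewrite gt_eqF.
have K_leR : K%:R * n%:R <= N%:R :> R by rewrite -natrM ler_nat.
have B_leR : B%:R * n%:R <= N%:R :> R by rewrite -natrM ler_nat.
have tL : 1 <= t%:R * L ^+ 2 by rewrite mulr_ege1 ?ler1n // exprn_ege1.
have tLN : N%:R <= t%:R * L ^+ 2 * N%:R by rewrite ler_peMl.
have lambda_ln2 : (t ^ n)%:R * lambda * n%:R <= 2 * N%:R * ln 2.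
  by apply: le_trans lambda_n _; rewrite mulrAC ler_peMl //; lra.
have q_upL := ler_wpM2r (le_trans ler01 L1) q_up.
(* Here [484 = 3 * 160 + 4]: the [q] steps give [3 * 160], [K] and [B] one [N] each, and [lambda]
   two, as its term is divided by [ln 2 >= 1 / 2]. *)
have total : (N + K + B)%:R * n%:R + 2 * N%:R + 3 * (q%:R * n%:R * L) <=
    (n%:R + 484 * (t%:R * L ^+ 2)) * N%:R.
  rewrite !natrD; lra.
have := ler_wpM2r (ltW ln2_gt0) total; rewrite lE natrM; lra.
Qed.

(** The square of the left side is [t * L ^ 3 / n] times [L * t / n <= 1]. *)
Lemma expr2_le_sqrt (R : realType) (t n L : R) :
    0 <= t -> 0 < n -> 0 <= L -> L * t <= n ->
  t * L ^+ 2 / n <= (t * L ^+ 3 / n) `^ (1 / 2).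
Proof.
move=> t0 n0 L0 Ltn.
have x0 : 0 <= t * L ^+ 2 / n by rewrite divr_ge0 ?mulr_ge0 ?exprn_ge0 // ltW.
have y0 : 0 <= t * L ^+ 3 / n by rewrite divr_ge0 ?mulr_ge0 ?exprn_ge0 // ltW.
rewrite div1r powR12_sqrt // -(ger0_norm x0) -sqrtr_sqr ler_wsqrtr //.
have -> : (t * L ^+ 2 / n) ^+ 2 = (t * L ^+ 3 / n) * (L * t / n).
  by field; rewrite gt_eqF.
by rewrite ler_piMr // ler_pdivrMr // mul1r.
Qed.

Theorem theorem1p5 (R : realType) :
  exists C : R, forall t n : nat,
    (1 <= t)%N -> (1 <= n)%N ->
    t%:R < n%:R / (100 * log2 (n%:R : R)) ->
    log2 ((num_antichains (grid t n))%:R : R) <=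
      (1 + C * (t%:R * log2 (n%:R : R) ^+ 3 / n%:R) `^ (1 / 2)) *
        (max_level_size t n)%:R.
Proof.
exists 484 => t n t_gt0 n_gt0; set L := log2 n%:R => Ltn.
have ln2_gt0 : 0 < ln 2 :> R by rewrite ln_gt0 // ltr1n.
(* For [n = 1] the hypothesis reads [t < 0], division by [log2 1 = 0] giving 0. *)
have n1 : (1 < n)%N.
  rewrite ltn_neqAle n_gt0 andbT; apply: contraTneq Ltn => n1.
  by rewrite /L /log2 -n1 ln1 mul0r mulr0 invr0 mulr0 -leNgt.
have L0 : 0 < L by rewrite /L /log2 divr_gt0 // ln_gt0 // ltr1n.
have {}Ltn : 100 * L * t%:R < n%:R.
  by rewrite mulrC -ltr_pdivlMr // mulr_gt0.
(* For [t = 1] the grid is a single point with at most two antichains, and its largest level does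
   not reach the size [n] used in the general estimate. *)
have [t1|t1] : (t = 1 \/ 1 < t)%N by lia.
  have N1 : (1 <= max_level_size t n)%N.
    by have := card_grid_leq t n; rewrite t1 exp1n muln0 mul1n.
  apply: (@le_trans _ _ 1).
    rewrite /log2 ler_pdivrMr // mul1r.
    have : (num_antichains (grid t n) <= 2)%N.
      apply: leq_trans (max_card _) _.
      by rewrite -cardsT -powersetT card_powerset cardsT card_grid t1 exp1n.
    (* The value 0 is covered by the convention [ln 0 = 0]. *)
    case: (num_antichains _) => [|a] a2; first by rewrite ln0 // ltW.
    by rewrite ler_ln ?posrE ?ltr0n // ler_nat.
  have N1R : 1 <= (max_level_size t n)%:R :> R by rewrite ler1n.
  by rewrite mulr_ege1 // lerDl mulr_ge0 // powR_ge0.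
apply: le_trans (log2_num_antichains_le t1 n1 erefl Ltn) _.
rewrite ler_wpM2r // lerD2l ler_wpM2l // -/L expr2_le_sqrt ?ltr0n ?(ltW L0) //.
by apply: le_trans (ltW Ltn); rewrite -mulrA ler_peMl ?ler1n // mulr_ge0 // ltW.
Qed.
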